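(* Let $\rho\in\mathcal R$ and $A_\rho\in\mathcal B(H_\rho)$. For every ambient extension $\widetilde A\in\operatorname{Ext}_\rho(A_\rho)$, $$\|\widetilde A\|_{\mathrm{op}}\ge\|A_\rho\|_{\mathcal B(H_\rho)}.$$ The zero-defect extension satisfies $$\|\widetilde A_\rho^{\,0}\|_{\mathrm{op}}=\|A_\rho\|_{\mathcal B(H_\rho)}.$$ Hence the zero-defect extension attains the minimum possible operator norm among all bounded ambient extensions of $A_\rho$.
   Context: Let $X=\mathbb R^n$ ($n\ge 1$) with its Borel $\sigma$-algebra and Lebesgue measure $\lambda$; functions are complex-valued. Let $\mathcal H=L^2(X,\lambda)$; $\mathcal B(E)$ denotes the bounded linear operators on $E$, and $\|\cdot\|_{\mathrm{op}}$ is the operator norm on $\mathcal B(\mathcal H)$. Let $\mathcal R=\{\rho\in L^1(X,\lambda):\rho\ge 0\ \lambda\text{-a.e.},\ \int_X\rho\,d\lambda=1\}$. For $\rho\in\mathcal R$ let $H_\rho=L^2(X,\rho\,d\lambda)$ and $V_\rho=\{u\in\mathcal H:u=0\ \lambda\text{-a.e. on }\{\rho=0\}\}$. The map $U_\rho:H_\rho\to V_\rho$, $U_\rho[f]_\rho=\sqrt\rho\,f$, is unitary. $Q_\rho u=\mathbf 1_{\{\rho>0\}}u$ is the orthogonal projection of $\mathcal H$ onto $V_\rho$. For $A_\rho\in\mathcal B(H_\rho)$, the aligned operator is $A_\rho^\sharp=U_\rho A_\rho U_\rho^{-1}:V_\rho\to V_\rho$. An ambient extension of $A_\rho$ is an operator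 $\widetilde A\in\mathcal B(\mathcal H)$ with $\widetilde A|_{V_\rho}=A_\rho^\sharp$; the set of all ambient extensions is $\operatorname{Ext}_\rho(A_\rho)$. The zero-defect extension is $\widetilde A_\rho^{\,0}=A_\rho^\sharp Q_\rho\in\mathcal B(\mathcal H)$. *)

(* Defs.v *)
From HB Require Import structures.
From mathcomp Require Import all_boot all_order all_algebra.
From mathcomp Require Import complex.
From mathcomp Require Import all_classical all_reals all_analysis.
From mathcomp Require Import measurable_realfun.

Set Implicit Arguments.
Unset Strict Implicit.
Unset Printing Implicit Defensive.

Import Order.TTheory GRing.Theory Num.Theory.
Import numFieldNormedType.Exports.

Local Open Scope classical_set_scope.
Local Open Scope ring_scope.
Local Open Scope complex_scope.

(* The sigma-algebra of [n.-tuple (measurableTypeR R)] is generated by the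
   coordinate preimages of Borel sets of R; R being second countable, this is
   the Borel sigma-algebra of R^n. *)
Notation Rn R n := (n.-tuple (measurableTypeR R)).

Section lebesgue_tuple.
Context (R : realType).

Section step.
Context (n : nat) (m : {sigma_finite_measure set (Rn R n) -> \bar R}).

Definition cons_pair (p : measurableTypeR R * Rn R n) : Rn R n.+1 :=
  [the n.+1.-tuple _ of p.1 :: p.2].

Definition cons_measure : set (Rn R n.+1) -> \bar R :=
  pushforward ((@lebesgue_measure R) \x m)%E cons_pair.

Let measurable_cons_pair : measurable_fun setT cons_pair.
Proof. exact: measurable_cons. Qed.

Let P : {measure set (Rn R n.+1) -> \bar R} :=
  measure_function_pushforward__canonical__measure_function_Measure
    ((@lebesgue_measure R) \x m)%E measurable_cons_pair.

HB.instance Definition _ := isMeasure.Build _ _ _ cons_measure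
  (measure0 P) (measure_ge0 P) (@measure_semi_sigma_additive _ _ _ P).

Definition uncons (t : Rn R n.+1) : measurableTypeR R * Rn R n :=
  (thead t, [tuple of behead t]).

Lemma uncons_measurable : measurable_fun setT uncons.
Proof.
apply/measurable_fun_pairP; split; first exact: measurable_tnth.
exact: measurable_behead.
Qed.

Lemma cons_pairK : cancel cons_pair uncons.
Proof. by move=> [x t]; congr pair; exact: val_inj. Qed.

Let cons_measure_sigma_finite : sigma_finite setT cons_measure.
Proof.
have /sigma_finiteP[F [TF ndF Foo]] := sigma_finiteT (@lebesgue_measure R).
have /sigma_finiteP[G [TG ndG Goo]] := sigma_finiteT m.
exists (fun k => uncons @^-1` (F k `*` G k)).
  rewrite -preimage_bigcup; apply/esym/seteqP; split => // t _.
  have [k _ Fk] : (\bigcup_k F k) (uncons t).1 by rewrite -TF.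
  have [l _ Gl] : (\bigcup_k G k) (uncons t).2 by rewrite -TG.
  exists (maxn k l) => //; split.
    by move: Fk; exact/subsetPset/ndF/leq_maxl.
  by move: Gl; exact/subsetPset/ndG/leq_maxr.
move=> k; have [mF Fk] := Foo k; have [mG Gk] := Goo k; split.
  by rewrite -[X in measurable X]setTI; apply: uncons_measurable => //; exact: measurableX.
rewrite /cons_measure /pushforward -comp_preimage.
suff -> : uncons \o cons_pair = id.
  by rewrite /= product_measure1E// lte_mul_pinfty// ge0_fin_numE.
by apply/funext => p /=; rewrite cons_pairK.
Qed.

HB.instance Definition _ := Measure_isSigmaFinite.Build _ _ _ cons_measure
  cons_measure_sigma_finite.

End step.

(* Lebesgue measure on R^n as the iterated product of Lebesgue measure on R,
   see [lebesgue_Rn_box]; R^0 is a point of mass 1. *)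
Fixpoint lebesgue_Rn (n : nat) : {sigma_finite_measure set (Rn R n) -> \bar R} :=
  if n is n'.+1 then cons_measure (lebesgue_Rn n') else \d_([tuple]).

Lemma lebesgue_Rn_box n (A : 'I_n -> set (measurableTypeR R)) :
  (forall i, measurable (A i)) ->
  lebesgue_Rn n [set t | forall i, A i (tnth t i)] =
  (\prod_(i < n) lebesgue_measure (A i))%E.
Proof.
elim: n A => [|n IHn] A mA /=.
  rewrite big_ord0 diracE mem_set//=; first by case.
have -> : [set t : Rn R n.+1 | forall i, A i (tnth t i)] =
    @uncons n @^-1` (A ord0 `*` [set t | forall i, A (lift ord0 i) (tnth t i)]).
  apply/seteqP; split => t /=.
    move=> At; split => [|i]; first exact: At.
    by have := At (lift ord0 i); rewrite {1}(tuple_eta t) tnthS.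
  move=> [/= A0 AS] i; case: (unliftP ord0 i) => [j ->|-> //].
  by rewrite (tuple_eta t) tnthS.
rewrite /cons_measure /pushforward -comp_preimage.
have -> : @uncons n \o @cons_pair n = id.
  by apply/funext => p /=; rewrite cons_pairK.
have mB : measurable [set t : Rn R n | forall i, A (lift ord0 i) (tnth t i)].
  rewrite [X in measurable X](_ : _ = \bigcap_(i : 'I_n)
      ((@tnth n _ ^~ i) @^-1` A (lift ord0 i))).
    apply: fin_bigcap_measurable => // i _; rewrite -[X in measurable X]setTI.
    exact: measurable_tnth.
  by apply/seteqP; split => t /= At i; [move=> _|]; exact: At.
rewrite /= product_measure1E// big_ord_recl; congr (_ * _)%E.
exact: (IHn (fun i => A (lift ord0 i))).
Qed.

End lebesgue_tuple.

Notation normc := ComplexField.Normc.normc.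
Notation reC f := (fun x => complex.Re (f x)).
Notation imC f := (fun x => complex.Im (f x)).

Section complex_aux.
Context (R : realType).
Implicit Types z w : R[i].

Lemma normcE z : normc z = Num.sqrt (complex.Re z ^+ 2 + complex.Im z ^+ 2).
Proof. by case: z. Qed.

Lemma normc_ge0 z : 0 <= normc z.
Proof. by rewrite normcE sqrtr_ge0. Qed.

Lemma normc_real (x : R) : normc x%:C = `|x|.
Proof. by rewrite normcE/= expr0n addr0 sqrtr_sqr. Qed.

Lemma ReD z w : complex.Re (z + w) = complex.Re z + complex.Re w.
Proof. by case: z; case: w. Qed.

Lemma ImD z w : complex.Im (z + w) = complex.Im z + complex.Im w.
Proof. by case: z; case: w. Qed.

Lemma ReM z w : complex.Re (z * w) =
  complex.Re z * complex.Re w - complex.Im z * complex.Im w.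
Proof. by case: z; case: w. Qed.

Lemma ImM z w : complex.Im (z * w) =
  complex.Re z * complex.Im w + complex.Im z * complex.Re w.
Proof. by case: z; case: w. Qed.

End complex_aux.

Section cmeasurable.
Context d (T : measurableType d) (R : realType).
Implicit Types f g : T -> R[i].

Definition cmeasurable f : Prop :=
  measurable_fun setT (reC f) /\ measurable_fun setT (imC f).

Lemma measurable_sqrt : measurable_fun setT (@Num.sqrt R).
Proof. by apply: continuous_measurable_fun; exact: sqrt_continuous. Qed.

Lemma measurable_normc f : cmeasurable f ->
  measurable_fun setT (fun x => normc (f x)).
Proof.
move=> [mRe mIm].
under eq_fun do rewrite normcE.
apply: (measurableT_comp measurable_sqrt); apply: measurable_funD;
  exact: measurable_funX.
Qed.

Lemma cmeasurable_real (r : T -> R) : measurable_fun setT r ->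
  cmeasurable (fun x => (r x)%:C).
Proof. by move=> mr; split => //=; exact: measurable_cst. Qed.

Lemma cmeasurableD f g : cmeasurable f -> cmeasurable g ->
  cmeasurable (fun x => f x + g x).
Proof.
move=> [? ?] [? ?]; split.
  by under eq_fun do rewrite ReD; exact: measurable_funD.
by under eq_fun do rewrite ImD; exact: measurable_funD.
Qed.

Lemma cmeasurableM f g : cmeasurable f -> cmeasurable g ->
  cmeasurable (fun x => f x * g x).
Proof.
move=> [? ?] [? ?]; split.
  under eq_fun do rewrite ReM.
  by apply: measurable_funB; exact: measurable_funM.
under eq_fun do rewrite ImM.
by apply: measurable_funD; exact: measurable_funM.
Qed.

Lemma cmeasurable_cst (c : R[i]) : cmeasurable (fun=> c).
Proof. by split; exact: measurable_cst. Qed.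

End cmeasurable.

Section L2.
Context d (T : measurableType d) (R : realType).
Variable mu : {measure set T -> \bar R}.
Implicit Types f g : T -> R[i].

Definition sqintegrable f : Prop :=
  cmeasurable f /\ finite_norm mu 2%:E (fun x => normc (f x)).

Lemma sqintegrable_Lfun f : sqintegrable f ->
  (fun x => normc (f x)) \in Lfun mu 2%:E.
Proof.
move=> [mf nf]; apply/andP; split; rewrite inE//=.
exact: measurable_normc.
Qed.

Let measurable_Lnorm2_integrand (f : T -> R) : measurable_fun setT f ->
  measurable_fun setT (fun x => `|(EFin \o f) x| `^ 2)%E.
Proof.
move=> mf; apply: (measurableT_comp (measurable_poweR _)).
by apply: measurableT_comp => //; exact/measurable_EFinP.
Qed.

Lemma le_Lnorm2 (f g : T -> R) : measurable_fun setT f -> measurable_fun setT g ->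
  (forall x, 0 <= f x <= g x) ->
  ('N[mu]_2%:E[EFin \o f] <= 'N[mu]_2%:E[EFin \o g])%E.
Proof.
move=> mf mg fg; rewrite unlock /Lnorm; apply: gt0_ler_poweR => //.
- by rewrite in_itv/= leey andbT; apply: integral_ge0 => x _; rewrite lee_fin powR_ge0.
- by rewrite in_itv/= leey andbT; apply: integral_ge0 => x _; rewrite lee_fin powR_ge0.
apply: ge0_le_integral => //.
- by move=> x _; exact: poweR_ge0.
- exact: measurable_Lnorm2_integrand.
- exact: measurable_Lnorm2_integrand.
move=> x _ /=; have /andP[f0 fgx] := fg x.
rewrite lee_fin ge0_ler_powR ?nnegrE// !ger0_norm ?(le_trans f0 fgx)//.
Qed.

Lemma ae_eq_Lnorm2 (f g : T -> R) : measurable_fun setT f -> measurable_fun setT g ->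
  f = g %[ae mu] -> ('N[mu]_2%:E[EFin \o f] = 'N[mu]_2%:E[EFin \o g])%E.
Proof.
move=> mf mg fg; rewrite unlock /Lnorm; congr (_ `^ _)%E.
apply: ge0_ae_eq_integral => //.
- exact: measurable_Lnorm2_integrand.
- exact: measurable_Lnorm2_integrand.
- by move=> x _; exact: poweR_ge0.
- by move=> x _; exact: poweR_ge0.
by apply: filterS fg => x /= /(_ I) -> .
Qed.

Definition L2pred : {pred T -> R[i]} := [pred f | `[< sqintegrable f >]].

Lemma L2predP f : reflect (sqintegrable f) (f \in L2pred).
Proof. exact: asboolP. Qed.

Lemma L2_submod_closed : submod_closed L2pred.
Proof.
split.
  apply/L2predP; split; first exact: cmeasurable_cst.
  rewrite /finite_norm.
  under [X in Lnorm _ _ (_ \o X)]eq_fun do rewrite ComplexField.Normc.normc0.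
  exact: (finite_norm_cst0 _ (lee1n 2)).
move=> a f g /L2predP [mf Nf] /L2predP[mg Ng]; apply/L2predP.
have mh : cmeasurable (a *: f + g).
  apply: (@cmeasurableD _ _ _ (fun x => a * f x) g) => //.
  exact: (@cmeasurableM _ _ _ (fun=> a) f (cmeasurable_cst _ a) mf).
split => //; rewrite /finite_norm.
have /andP[mk Nk] : normc a *: (fun x => normc (f x)) + (fun x => normc (g x)) \in Lfun mu 2%:E.
  apply: (Lfun_submod_closed mu (lee1n 2)).2; exact: sqintegrable_Lfun.
move: mk Nk; rewrite !inE/= => mk; apply: le_lt_trans.
apply: le_Lnorm2 => //; first exact: measurable_normc.
move=> x; rewrite normc_ge0/=.
by rewrite (le_trans (le_normcD _ _))// ComplexField.Normc.normcM.
Qed.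

HB.instance Definition _ := GRing.isSubmodClosed.Build _ _ L2pred L2_submod_closed.

Record L2fun := MkL2fun { L2val :> T -> R[i]; L2valP : L2val \in L2pred }.

HB.instance Definition _ := [isSub for L2val].
HB.instance Definition _ := [Choice of L2fun by <:].
HB.instance Definition _ := [SubChoice_isSubLmodule of L2fun by <:].

Definition L2null : {pred L2fun} :=
  [pred f : L2fun | `[< {ae mu, forall x, f x = 0} >]].

Lemma L2nullP (f : L2fun) : reflect {ae mu, forall x, f x = 0} (f \in L2null).
Proof. exact: asboolP. Qed.

Lemma L2null_submod_closed : submod_closed L2null.
Proof.
split; first by apply/L2nullP; exact: aeW.
move=> a f g /L2nullP f0 /L2nullP g0; apply/L2nullP.
by apply: filterS2 f0 g0 => x /= f0 g0; rewrite -[LHS]/(a * f x + g x) f0 g0 mulr0 addr0.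
Qed.

HB.instance Definition _ := GRing.isSubmodClosed.Build _ _ L2null L2null_submod_closed.

(* Complex square-integrable functions modulo a.e. equality, as a vector space
   over R[i]. The norm below is real-valued, hence the instance of
   [normedZmodType R] rather than of a normed module over R[i]. *)
Definition L2 := Quotient.quot L2null.
HB.instance Definition _ := GRing.Zmodule.on L2.
HB.instance Definition _ := EqQuotient.on L2.

Definition L2rep (u : L2) : L2fun := repr u.
Coercion L2rep : L2 >-> L2fun.


Local Open Scope quotient_scope.

Lemma L2eqP (f g : L2fun) :
  reflect (f = g %[ae mu]) (f == g %[mod L2]).
Proof.
rewrite -Quotient.idealrBE; apply: (iffP (L2nullP _)).
  by apply: filterS => x /eqP; rewrite subr_eq0 => /eqP.
by apply: filterS => x /= /(_ I) fg; apply/eqP; rewrite subr_eq0 fg.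
Qed.

Lemma L2reprK (f : L2fun) : repr (\pi_L2 f) = f %[ae mu].
Proof. by apply/L2eqP; rewrite reprK. Qed.

Definition L2scale (a : R[i]) (u : L2) : L2 := \pi_L2 (a *: repr u).

Lemma pi_L2scale a (f : L2fun) : \pi_L2 (a *: f) = L2scale a (\pi_L2 f).
Proof.
rewrite /L2scale; apply/eqP; apply: (introT (@L2eqP _ _)); have := L2reprK f; apply: filterS => x /= /(_ I) fx _.
by rewrite -[LHS]/(a * f x) -fx.
Qed.

Let scaleA a b u : L2scale a (L2scale b u) = L2scale (a * b) u.
Proof. by rewrite -[u]reprK -(pi_L2scale b) -!pi_L2scale scalerA. Qed.

Let scale1 u : L2scale 1 u = u.
Proof. by rewrite -[u]reprK -pi_L2scale scale1r. Qed.

Let scaleDr a : {morph L2scale a : u v / u + v}.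
Proof.
move=> u v; rewrite -[u]reprK -[v]reprK -!pi_L2scale.
by rewrite -!(raddfD (\pi_L2)) -pi_L2scale scalerDr.
Qed.

Let scaleDl u : {morph L2scale^~ u : a b / a + b}.
Proof.
move=> a b; rewrite -[u]reprK -!pi_L2scale.
by rewrite -!(raddfD (\pi_L2)) scalerDl.
Qed.

HB.instance Definition _ :=
  GRing.Zmodule_isLmodule.Build R[i] L2 scaleA scale1 scaleDr scaleDl.

Lemma pi_L2_linear a (f g : L2fun) :
  \pi_L2 (a *: f + g) = a *: \pi_L2 f + \pi_L2 g.
Proof. by rewrite (raddfD (\pi_L2)); congr (_ + _); exact: pi_L2scale. Qed.

Definition L2norm (u : L2) : R :=
  fine 'N[mu]_2%:E[EFin \o (fun x => normc (u x))]%E.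

Lemma L2fun_normc_Lfun (f : L2fun) : (fun x => normc (f x)) \in Lfun mu 2%:E.
Proof. exact/sqintegrable_Lfun/L2predP/L2valP. Qed.

Lemma pi_L2norm (f : L2fun) :
  (L2norm (\pi_L2 f))%:E = 'N[mu]_2%:E[EFin \o (fun x => normc (f x))]%E.
Proof.
have /L2predP[mr nr] := L2valP (repr (\pi_L2 f)).
have /L2predP[mf nf] := L2valP f.
rewrite /L2norm fineK; last by rewrite ge0_fin_numE ?Lnorm_ge0.
apply: ae_eq_Lnorm2; [exact: measurable_normc..|].
by apply: filterS (L2reprK f) => x /= fx _; rewrite fx.
Qed.

Let L2normD u v : L2norm (u + v) <= L2norm u + L2norm v.
Proof.
rewrite -[u]reprK -[v]reprK; move: (repr u) (repr v) => {u v} f g.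
rewrite -(raddfD (\pi_L2)) -lee_fin EFinD !pi_L2norm.
have /L2predP[mf nf] := L2valP f; have /L2predP[mg ng] := L2valP g.
have /L2predP[mh nh] := L2valP (f + g).
have mnf := measurable_normc mf; have mng := measurable_normc mg.
have := @minkowski _ _ _ mu _ _ 2 mnf mng.
rewrite ler1n => /(_ isT); apply: le_trans.
apply: le_Lnorm2; [exact: measurable_normc|exact: measurable_funD|].
by move=> x; rewrite normc_ge0/= le_normcD.
Qed.

Lemma L2normZ a u : L2norm (a *: u) = normc a * L2norm u.
Proof.
rewrite -[u]reprK; move: (repr u) => {u} f; apply: EFin_inj.
rewrite [_ *: _](esym (pi_L2scale _ _)) EFinM !pi_L2norm.
have /= := @LnormZ _ _ _ mu 2%:E (lee1n 2) (Lfun_Sub _ (L2fun_normc_Lfun f)) (normc a).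
rewrite ger0_norm ?normc_ge0// => <-.
congr Lnorm; apply/funext => x; congr EFin.
exact: ComplexField.Normc.normcM.
Qed.

Let L2norm0 u : L2norm u = 0 -> u = 0.
Proof.
rewrite -[u]reprK; move: (repr u) => {u} f n0; have f0 := pi_L2norm f.
rewrite n0 in f0; move/esym in f0.
have /L2predP[mf nf] := L2valP f.
rewrite -(raddf0 (\pi_L2)); apply/eqP/L2eqP.
have m2 : measurable_fun setT (EFin \o (fun x => normc (f x))).
  by apply/measurable_EFinP; exact: measurable_normc.
have lt02 : (0 < 2%:E :> \bar R)%E by rewrite lte_fin.
have := Lnorm_eq0_eq0 m2 lt02 f0; apply: filterS => x /(_ I) [nf0] _.
exact: ComplexField.Normc.eq0_normc.
Qed.

Let L2normN u : L2norm (- u) = L2norm u.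
Proof.
by rewrite -scaleN1r L2normZ -(rmorph1 (real_complex R)) -rmorphN normc_real normrN1 mul1r.
Qed.

Let L2normMn u n : L2norm (u *+ n) = L2norm u *+ n.
Proof.
rewrite -scaler_nat L2normZ -(rmorph_nat (real_complex R)) normc_real.
by rewrite normr_nat mulr_natl.
Qed.

HB.instance Definition _ :=
  Num.Zmodule_isNormed.Build R L2 L2normD L2norm0 L2normMn L2normN.

End L2.

Section density.
Context d (T : measurableType d) (R : realType).
Variable lam : {measure set T -> \bar R}.

Record prob_density := Density {
  dens :> T -> R;
  dens_integrable : lam.-integrable setT (EFin \o dens);
  dens_ge0 : {ae lam, forall x, 0 <= dens x};
  dens_mass1 : (\int[lam]_x (dens x)%:E = 1)%E
}.

Variable rho : prob_density.

(* A density is only a.e. nonnegative: its positive part, which is a.e. equal to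
   it, makes the set function rho dlam nonnegative on the nose. *)
Definition dens_pos (x : T) : R := Num.max (rho x) 0.

Definition density_measure (A : set T) : \bar R :=
  (\int[lam]_(x in A) (dens_pos x)%:E)%E.

Lemma measurable_dens : measurable_fun setT rho.
Proof. exact/measurable_EFinP/measurable_int/dens_integrable. Qed.

Lemma measurable_dens_pos : measurable_fun setT (EFin \o dens_pos).
Proof.
apply/measurable_EFinP; apply: measurable_maxr; first exact: measurable_dens.
exact: measurable_cst.
Qed.

Lemma dens_pos_ge0 x : (0 <= (dens_pos x)%:E)%E.
Proof. by rewrite lee_fin le_max lexx orbT. Qed.

Let density_measure0 : density_measure set0 = 0%E.
Proof. exact: integral_set0. Qed.

Let density_measure_ge0 A : (0 <= density_measure A)%E.
Proof. by apply: integral_ge0 => x _; exact: dens_pos_ge0. Qed.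

Let density_measure_sigma_additive : semi_sigma_additive density_measure.
Proof.
move=> F mF tF mUF; rewrite [X in _ --> X](_ : _ =
    \sum_(0 <= k <oo) density_measure (F k))%E; last first.
  rewrite /density_measure ge0_integral_bigcup//.
  - exact: measurable_funTS measurable_dens_pos.
  - by move=> x _; exact: dens_pos_ge0.
exact: is_cvg_nneseries.
Qed.

HB.instance Definition _ := isMeasure.Build _ _ _ density_measure
  density_measure0 density_measure_ge0 density_measure_sigma_additive.

Import HBNNSimple.

Lemma ge0_integral_density (f : T -> \bar R) : (forall x, 0 <= f x)%E ->
  measurable_fun setT f ->
  (\int[density_measure]_x f x = \int[lam]_x (f x * (dens_pos x)%:E))%E.
Proof.
move=> f0 mf; set g := fun x => (dens_pos x)%:E.
have mg : measurable_fun setT g := measurable_dens_pos.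
have g0 x : (0 <= g x)%E := dens_pos_ge0 x.
pose h := nnsfun_approx measurableT mf.
have -> : (\int[density_measure]_x f x =
    lim (\int[density_measure]_x (EFin \o h n) x @[n --> \oo]))%E.
  have fE x : f x = lim ((EFin \o h n) x @[n --> \oo]).
    by apply/esym/cvg_lim => //; apply: cvg_nnsfun_approx.
  under eq_integral => x _ do rewrite fE.
  apply: monotone_convergence => //.
  - by move=> n; exact/measurable_EFinP.
  - by move=> n x _ /=; rewrite lee_fin.
  - by move=> x _ a b ab; rewrite lee_fin; exact/lefP/nd_nnsfun_approx.
have -> : (\int[lam]_x (f x * g x) =
    lim (\int[lam]_x ((EFin \o h n) x * g x) @[n --> \oo]))%E.
  have fg x : (f x * g x)%E = lim (((EFin \o h n) x * g x)%E @[n --> \oo]).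
    by apply/esym/cvg_lim => //; apply: cvgeZr => //; apply: cvg_nnsfun_approx.
  under eq_integral => x _ do rewrite fg.
  apply: monotone_convergence => [//| | |].
  - by move=> n; apply: emeasurable_funM => //; exact/measurable_EFinP.
  - by move=> n x _; rewrite mule_ge0 ?lee_fin//; exact: dens_pos_ge0.
  - by move=> x _ a b ab/=; rewrite lee_wpmul2r ?g0 ?lee_fin//; exact/lefP/nd_nnsfun_approx.
suff suf n : (\int[lam]_x ((EFin \o h n) x * g x) =
    \int[density_measure]_x (EFin \o h n) x)%E.
  by under [in RHS]eq_fun do rewrite suf.
transitivity (\int[density_measure]_x
   (\sum_(y \in range (h n)) (y * \1_(h n @^-1` [set y]) x)%:E))%E; last first.
  by apply: eq_integral => t _; rewrite /= fimfunE -fsumEFin.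
have indich m r : measurable_fun setT (fun x => (r * \1_(h m @^-1` [set r]) x)%:E).
  by apply/measurable_EFinP; exact: measurable_funM.
rewrite ge0_integral_fsum//; last by move=> m y _; exact: nnfun_muleindic_ge0.
transitivity (\int[lam]_x (\sum_(y \in range (h n))
    (y * \1_(h n @^-1` [set y]) x)%:E * g x))%E.
  under [RHS]eq_integral => x _.
    rewrite -ge0_mule_fsuml => [|y]; last exact: nnfun_muleindic_ge0.
    rewrite fsumEFin // -(fimfunE _ x); over.
  by [].
rewrite ge0_integral_fsum//; last 2 first.
  - by move=> y; apply: emeasurable_funM.
  - by move=> m y _; rewrite mule_ge0 ?g0// nnfun_muleindic_ge0.
apply: eq_fsbigr => r rhn.
under [RHS]eq_integral do rewrite EFinM.
rewrite integralZl_indic_nnsfun => //.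
under eq_integral do rewrite EFinM -muleA.
rewrite ge0_integralZl//.
- under eq_integral do rewrite muleC.
  rewrite (eq_integral (g \_ (h n @^-1` [set r]))); last first.
    by move=> x _; rewrite epatch_indic.
  by rewrite -integral_mkcond integral_indic// setIT.
- by apply: emeasurable_funM => //; exact/measurable_EFinP.
- by move=> t _; rewrite mule_ge0 ?g0// lee_fin.
- by move: rhn; rewrite inE => -[t _ <-]; rewrite lee_fin.
Qed.

End density.

Section aligned.
Context d (T : measurableType d) (R : realType).
Variables (lam : {measure set T -> \bar R}) (rho : prob_density lam).

Local Open Scope quotient_scope.

Notation H := (L2 lam).
Notation Hrho := (L2 (density_measure rho)).

Definition sqrt_mul (f : T -> R[i]) : T -> R[i] :=
  fun x => (Num.sqrt (rho x))%:C * f x.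

Lemma cmeasurable_sqrt_mul f : cmeasurable f -> cmeasurable (sqrt_mul f).
Proof.
move=> mf; apply: cmeasurableM => //; apply: cmeasurable_real.
exact: measurableT_comp (@measurable_sqrt R) (measurable_dens rho).
Qed.

Lemma sqr_sqrt_dens x : Num.sqrt (rho x) ^+ 2 = dens_pos rho x.
Proof.
rewrite /dens_pos; have [r0|r0] := leP (rho x) 0.
  by rewrite ler0_sqrtr// expr0n.
by rewrite sqr_sqrtr// ltW.
Qed.

Lemma Lnorm_sqrt_mul (f : T -> R[i]) : cmeasurable f ->
  ('N[lam]_2%:E[EFin \o (fun x => normc (sqrt_mul f x))] =
   'N[density_measure rho]_2%:E[EFin \o (fun x => normc (f x))])%E.
Proof.
move=> mf; rewrite unlock /Lnorm; congr (_ `^ _)%E.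
rewrite ge0_integral_density; last 2 first.
- by move=> x; exact: poweR_ge0.
- apply: (measurableT_comp (measurable_poweR _)); apply: measurableT_comp => //.
  by apply/measurable_EFinP; exact: measurable_normc.
apply: eq_integral => x _ /=.
rewrite ComplexField.Normc.normcM normc_real -sqr_sqrt_dens -EFinM.
rewrite !powR_mulrn ?normr_ge0// normrM exprMn mulrC normr_id.
by rewrite (ger0_norm (sqrtr_ge0 _)).
Qed.

Lemma sqintegrable_sqrt_mul (f : L2fun (density_measure rho)) :
  sqrt_mul f \in L2pred lam.
Proof.
have /L2predP[mf nf] := L2valP f.
apply/L2predP; split; first exact: cmeasurable_sqrt_mul.
by rewrite /finite_norm Lnorm_sqrt_mul.
Qed.

Definition U_rho (u : Hrho) : H := \pi_(L2 lam) (MkL2fun (sqintegrable_sqrt_mul u)).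

Definition V_rho : set H := [set u | {ae lam, forall x, rho x = 0 -> u x = 0}].

Definition supp_mul (f : T -> R[i]) : T -> R[i] :=
  fun x => (\1_[set y | 0 < rho y] x)%:C * f x.

Lemma sqintegrable_supp_mul (f : L2fun lam) : supp_mul f \in L2pred lam.
Proof.
have /L2predP[mf nf] := L2valP f.
have m : cmeasurable (supp_mul f).
  apply: cmeasurableM => //; apply: cmeasurable_real; apply: measurable_indic.
  have := measurable_dens rho => /(_ measurableT _ (measurable_itv `]0, +oo[)).
  rewrite setTI; congr measurable; apply/seteqP; split => x /=;
  by rewrite in_itv/= andbT.
apply/L2predP; split => //; apply: le_lt_trans nf.
apply: le_Lnorm2; [exact: measurable_normc..|] => x.
rewrite normc_ge0/= ComplexField.Normc.normcM normc_real indicE.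
by case: (_ \in _) => /=; rewrite ?normr1 ?mul1r// normr0 mul0r normc_ge0.
Qed.

Definition Q_rho (u : H) : H := \pi_(L2 lam) (MkL2fun (sqintegrable_supp_mul u)).

(* The partial inverse of [U_rho] is its genuine inverse on [V_rho], by
   [U_rho_bij]. [aligned A] is only meaningful on [V_rho]. *)
Definition aligned (A : Hrho -> Hrho) : H -> H :=
  U_rho \o A \o 'pinv_(fun=> 0) setT U_rho.

Definition zero_defect (A : Hrho -> Hrho) : H -> H := aligned A \o Q_rho.

Lemma pi_U_rho (f : L2fun (density_measure rho)) :
  U_rho (\pi_(L2 (density_measure rho)) f) = \pi_(L2 lam) (MkL2fun (sqintegrable_sqrt_mul f)).
Proof.
rewrite /U_rho; set g := L2rep _; set sg := MkL2fun _; set sf := MkL2fun _.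
pose k := MkL2fun (sqintegrable_sqrt_mul (g - f)).
have kE : k = sg - sf.
  by apply: val_inj; apply/funext => x; exact: mulrBr.
have k0 : \pi_(L2 lam) k = 0.
  apply/eqP; rewrite -normr_eq0; apply/eqP/EFin_inj.
  rewrite [LHS](pi_L2norm k) /= Lnorm_sqrt_mul; last first.
    by have /L2predP[] := L2valP (g - f).
  have gf : \pi_(L2 (density_measure rho)) (g - f) = 0 :> Hrho.
    rewrite (raddfB (\pi_(L2 (density_measure rho)))); apply/eqP.
    by rewrite subr_eq0; apply/eqP; exact: reprK.
  by rewrite -[LHS](pi_L2norm (g - f)) gf -[L2norm 0]/`|0 : Hrho| normr0.
apply/eqP; rewrite -subr_eq0 -(raddfB (\pi_(L2 lam))) -kE; apply/eqP.
exact: k0.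
Qed.

Lemma U_rho_linear : linear U_rho.
Proof.
move=> a u v; rewrite -[u]reprK -[v]reprK; move: (repr u) (repr v) => {u v} f g.
rewrite -pi_L2_linear !pi_U_rho -pi_L2_linear; congr (\pi_(L2 lam) _).
apply: val_inj; apply/funext => x.
by rewrite /= /sqrt_mul mulrDr; congr (_ + _); rewrite mulrCA.
Qed.

Lemma U_rho_norm u : `|U_rho u| = `|u|.
Proof.
rewrite -[u]reprK pi_U_rho; apply: EFin_inj.
rewrite [LHS](pi_L2norm _) [RHS](pi_L2norm _)/= Lnorm_sqrt_mul//.
by have /L2predP[] := L2valP (repr u).
Qed.

Lemma U_rho_bij : set_bij setT V_rho U_rho.
Proof.
split.
- move=> u _; have := L2reprK (MkL2fun (sqintegrable_sqrt_mul u)).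
  apply: filterS => x /(_ I) + rx0; rewrite -[X in X x = _]/(U_rho u : T -> R[i]) => ->.
  by rewrite /= /sqrt_mul rx0 sqrtr0 mul0r.
- move=> u v _ _ Uuv; apply/eqP; rewrite -subr_eq0 -normr_eq0 -U_rho_norm.
  by rewrite addrC -scaleN1r U_rho_linear Uuv scaleN1r addNr normr0.
move=> v Vv.
pose f x := (Num.sqrt (rho x))^-1%:C * v x.
have /L2predP[mv nv] := L2valP v.
have mf : cmeasurable f.
  apply: cmeasurableM => //; apply: cmeasurable_real.
  have -> : (fun x => (Num.sqrt (rho x))^-1) =
      (fun r : R => r `^ (-1)) \o (@Num.sqrt R) \o rho.
    by apply/funext => x /=; rewrite powR_inv1// sqrtr_ge0.
  apply: measurableT_comp (measurable_dens rho).
  exact: measurableT_comp (measurable_powR _) (@measurable_sqrt R).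
have sf x : sqrt_mul f x = if 0 < rho x then v x else 0.
  rewrite /sqrt_mul /f mulrA -rmorphM; case: ifPn => r0.
    by rewrite mulfV ?mul1r// gt_eqF// sqrtr_gt0.
  by rewrite ler0_sqrtr ?leNgt// mul0r mul0r.
have Lf : f \in L2pred (density_measure rho).
  apply/L2predP; split => //; rewrite /finite_norm -Lnorm_sqrt_mul//.
  apply: le_lt_trans nv; apply: le_Lnorm2.
  - exact/measurable_normc/cmeasurable_sqrt_mul.
  - exact: measurable_normc.
  move=> x; rewrite normc_ge0/= sf; case: ifPn => // _.
  by rewrite ComplexField.Normc.normc0 normc_ge0.
exists (\pi_(L2 (density_measure rho)) (MkL2fun Lf)) => //.
rewrite pi_U_rho -[RHS]reprK; apply/eqP/L2eqP.
apply: filterS2 Vv (dens_ge0 rho) => x vx r0 _ /=; rewrite sf.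
by case: ifPn => // nr0; rewrite vx//; apply/eqP; rewrite eq_le r0 leNgt nr0.
Qed.

End aligned.

Section operators.
Context d (T : measurableType d) (R : realType).
Variables (mu : {measure set T -> \bar R}).

Definition bounded_op : set (L2 mu -> L2 mu) :=
  [set A : L2 mu -> L2 mu | linear A /\ exists M : R, forall u : L2 mu, `|A u| <= M * `|u|].

(* Meaningful for bounded operators: [sup] is 0 on unbounded sets. *)
Definition opnorm (A : L2 mu -> L2 mu) : R :=
  sup [set `|A u| | u in [set u | `|u| <= 1]].

End operators.

Definition ambient_ext d (T : measurableType d) (R : realType)
    (lam : {measure set T -> \bar R}) (rho : prob_density lam)
    (A : L2 (density_measure rho) -> L2 (density_measure rho)) :
    set (L2 lam -> L2 lam) :=
  [set B : L2 lam -> L2 lam | bounded_op B /\ forall u, V_rho rho u -> B u = aligned A u].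

(* Main.v *)
(** Both inequalities come from [U_rho] being an isometry onto [V_rho]: every
    ambient extension [B] satisfies [B (U_rho u) = U_rho (A u)], so
    [`|A u| = `|B (U_rho u)|] with [`|U_rho u| = `|u|]; conversely the zero-defect
    extension sends [u] to [U_rho (A f)] where [U_rho f = Q_rho u], and
    [`|f| = `|Q_rho u| <= `|u|]. *)
Require Import Defs.
From HB Require Import structures.
From mathcomp Require Import all_boot all_order all_algebra.
From mathcomp Require Import complex.
From mathcomp Require Import all_classical all_reals all_analysis.

Set Implicit Arguments.
Unset Strict Implicit.
Unset Printing Implicit Defensive.

Import Order.TTheory GRing.Theory Num.Theory.
Import numFieldNormedType.Exports.

Local Open Scope classical_set_scope.
Local Open Scope ring_scope.

Section opnorm.
Context d (T : measurableType d) (R : realType).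
Variables (mu : {measure set T -> \bar R}).
Implicit Type A : L2 mu -> L2 mu.

(** Boundedness makes the set under [sup] bounded above, so that [sup] is a genuine upper bound. *)
Lemma le_opnorm A u : bounded_op A -> `|u| <= 1 -> `|A u| <= opnorm A.
Proof.
move=> [_ [M AM]] u1; apply: ub_le_sup; last by exists u.
(* The constant [M] may be negative; [|M|] is monotone under multiplication by norms. *)
exists `|M| => _ [v v1 <-]; rewrite (le_trans (AM v))//.
rewrite (le_trans (ler_wpM2r _ (ler_norm M)))//.
by rewrite ler_piMr.
Qed.

Lemma opnorm_le A (c : R) :
  (forall u, `|u| <= 1 -> `|A u| <= c) -> opnorm A <= c.
Proof.
move=> Ac; apply: ge_sup; first by exists `|A 0|, 0 => //=; rewrite normr0.
by move=> _ [u u1 <-]; exact: Ac.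
Qed.

End opnorm.

Section ambient_extensions.
Context d (T : measurableType d) (R : realType).
Variables (lam : {measure set T -> \bar R}) (rho : prob_density lam).
Implicit Types (A : L2 (density_measure rho) -> L2 (density_measure rho)).

Local Open Scope quotient_scope.

(** [Q_rho] is defined through a chosen representative; this frees it from that choice, as a.e.
    equal functions stay a.e. equal after truncation. *)
Lemma pi_Q_rho (f : L2fun lam) :
  Q_rho rho (\pi_(L2 lam) f) = \pi_(L2 lam) (MkL2fun (sqintegrable_supp_mul rho f)).
Proof.
apply/eqP/L2eqP; have := L2reprK f; apply: filterS => x /(_ I) fx _.
by rewrite /= /supp_mul /L2rep fx.
Qed.

Lemma Q_rho_linear : linear (Q_rho rho).
Proof.
move=> a u v; rewrite -[u]reprK -[v]reprK; move: (repr u) (repr v) => {u v} f g.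
rewrite -pi_L2_linear !pi_Q_rho -pi_L2_linear; congr (\pi_(L2 lam) _).
apply: val_inj; apply/funext => x.
by rewrite /= /supp_mul mulrDr; congr (_ + _); rewrite mulrCA.
Qed.

Lemma Q_rho_norm_le u : `|Q_rho rho u| <= `|u|.
Proof.
rewrite -[u]reprK pi_Q_rho -lee_fin.
rewrite [leLHS](pi_L2norm _) [leRHS](pi_L2norm _).
have /L2predP[mf _] := L2valP (repr u).
have /L2predP[mQ _] := L2valP (MkL2fun (sqintegrable_supp_mul rho (repr u))).
apply: le_Lnorm2; [exact: measurable_normc..|] => x.
rewrite normc_ge0/= /supp_mul ComplexField.Normc.normcM normc_real indicE.
by case: (_ \in _) => /=; rewrite ?normr1 ?mul1r// normr0 mul0r normc_ge0.
Qed.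

Lemma V_rho_Q u : V_rho rho (Q_rho rho u).
Proof.
have := L2reprK (MkL2fun (sqintegrable_supp_mul rho u)).
apply: filterS => x /(_ I) + rx0; rewrite -[X in X x = _]/(Q_rho rho u : T -> R[i]) => ->.
by rewrite /= /supp_mul indicE memNset/= ?mul0r// rx0 ltxx.
Qed.

Lemma Q_rho_id u : V_rho rho u -> Q_rho rho u = u.
Proof.
move=> Vu; rewrite -[RHS]reprK; apply/eqP/L2eqP.
(* Off [0 < rho x], the a.e. nonnegativity of the density forces [rho x = 0], where [u] vanishes. *)
apply: filterS2 Vu (dens_ge0 rho) => x ux r0 _; rewrite /= /supp_mul indicE.
have [r_gt0|r_le0] := ltP 0 (rho x); first by rewrite mem_set// mul1r.
have rx0 : rho x = 0 by apply/eqP; rewrite eq_le r0 r_le0.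
by rewrite [u x]ux// mulr0.
Qed.

(** Injectivity of [U_rho] makes the partial inverse cancel it, so ['pinv_] need not be unfolded
    afterwards. *)
Lemma aligned_U A u : aligned A (U_rho u) = U_rho (A u).
Proof.
have [_ Uinj _] := U_rho_bij rho.
by rewrite /aligned /= pinvKV// inE.
Qed.

Lemma zero_defectE A u f : U_rho f = Q_rho rho u ->
  zero_defect A u = U_rho (A f).
Proof. by move=> Uf; rewrite /zero_defect /= -Uf aligned_U. Qed.

Lemma Q_rho_preimage u : exists f : L2 (density_measure rho), U_rho f = Q_rho rho u.
Proof.
by have [_ _ Usurj] := U_rho_bij rho; have [f _ fu] := Usurj _ (V_rho_Q u); exists f.
Qed.

Lemma zero_defect_ambient_ext A : bounded_op A -> ambient_ext A (zero_defect A).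
Proof.
move=> [Alin [M AM]]; split; last by move=> u Vu; rewrite /zero_defect /= Q_rho_id.
split.
  (* Linearity is read off preimages instead of the partial inverse: [a *: f + g] is a preimage of
     [Q_rho rho (a *: u + v)]. *)
  move=> a u v; have [f fu] := Q_rho_preimage u; have [g gv] := Q_rho_preimage v.
  rewrite (zero_defectE A fu) (zero_defectE A gv) -U_rho_linear -Alin.
  by apply: zero_defectE; rewrite U_rho_linear Q_rho_linear fu gv.
exists `|M| => u; have [f fu] := Q_rho_preimage u.
rewrite (zero_defectE A fu) U_rho_norm (le_trans (AM f))//.
rewrite (le_trans (ler_wpM2r _ (ler_norm M)))// ler_wpM2l//.
by rewrite -U_rho_norm fu Q_rho_norm_le.
Qed.

Lemma opnorm_le_ambient_ext A B : ambient_ext A B -> opnorm A <= opnorm B.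
Proof.
move=> [Bbnd BA]; apply: opnorm_le => u u1.
have [UV _ _] := U_rho_bij rho.
(* The unit vector test for [A] at [u] becomes one for [B] at [U_rho u], which lies in [V_rho]. *)
rewrite -U_rho_norm -aligned_U -BA; last exact: UV.
by apply: le_opnorm; rewrite ?U_rho_norm.
Qed.

Lemma opnorm_zero_defect_le A : bounded_op A -> opnorm (zero_defect A) <= opnorm A.
Proof.
move=> Abnd; apply: opnorm_le => u u1; have [f fu] := Q_rho_preimage u.
rewrite (zero_defectE A fu) U_rho_norm; apply: le_opnorm => //.
by rewrite -U_rho_norm fu (le_trans (Q_rho_norm_le u)).
Qed.

End ambient_extensions.

Theorem theorem6p1 (R : realType) (n : nat) (n_ge1 : (1 <= n)%N)
  (rho : prob_density (lebesgue_Rn R n))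
  (A : L2 (density_measure rho) -> L2 (density_measure rho))
  (A_bounded : bounded_op A) :
  [/\ (forall B : L2 (lebesgue_Rn R n) -> L2 (lebesgue_Rn R n),
        ambient_ext A B -> opnorm A <= opnorm B),
      opnorm (zero_defect A) = opnorm A
    & ambient_ext A (zero_defect A) /\
      forall B : L2 (lebesgue_Rn R n) -> L2 (lebesgue_Rn R n),
        ambient_ext A B -> opnorm (zero_defect A) <= opnorm B].
Proof.
have ext0 := zero_defect_ambient_ext A_bounded.
have eq0 : opnorm (zero_defect A) = opnorm A.
  (* The lower bound is the general one, applied to the zero-defect extension through [ext0]. *)
  by apply/eqP; rewrite eq_le opnorm_zero_defect_le// opnorm_le_ambient_ext.
split=> [B||]; [exact: opnorm_le_ambient_ext|by []|].
by split=> // B; rewrite eq0; exact: opnorm_le_ambient_ext.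
Qed.
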